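(* Let $A\in M_2(\mathbb{T})$ with $|A|\neq -\infty$. Then $A^{\nabla}$ is a generalized inverse of $A$, i.e. $A A^{\nabla} A=A$ and $A^{\nabla} A A^{\nabla}=A^{\nabla}$ in $M_2(\mathbb{T})$.
   Context: The tropical semiring is $\mathbb{T}=\mathbb{R}\cup\{-\infty\}$ with addition $a\oplus b=\max\{a,b\}$ and multiplication $a\odot b=a+b$ (with $-\infty$ absorbing for $\odot$). $M_2(\mathbb{T})$ is the set of $2\times 2$ matrices over $\mathbb{T}$ with matrix multiplication induced by $\oplus,\odot$. For $A=\begin{pmatrix} a&b\\ c&d\end{pmatrix}$ the tropical determinant is $|A|=(a\odot d)\oplus(b\odot c)$. The adjoint $\operatorname{Adj}(A)$ is the transpose of the matrix whose $(i,j)$ entry is the tropical determinant of the minor obtained by deleting row $i$ and column $j$ of $A$ (no signs), so for this $A$, $\operatorname{Adj}(A)=\begin{pmatrix} d&b\\ c&a\end{pmatrix}$. When $|A|\ne-\infty$, $A^{\nabla}:=\operatorname{Adj}(A)/|A|$, where the division is tropical, i.e. $|A|$ is subtracted (in the usual sense) from every entry of $\operatorname{Adj}(A)$, entries $-\infty$ staying $-\infty$. *)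

(* Defs.v *)
From HB Require Import structures.
From mathcomp Require Import all_boot all_order all_fingroup all_algebra.
From mathcomp Require Import reals.

Set Implicit Arguments.
Unset Strict Implicit.
Unset Printing Implicit Defensive.

Import Order.TTheory GRing.Theory Num.Theory.
Local Open Scope ring_scope.

(* The tropical semiring R \cup {-oo}.  The semiring instance below makes
   [+], [*], [0], [1] on [trop R] stand for max, real addition, [NegInf] and
   [Fin 0], so MathComp's [*m] on ['M[trop R]_n] is the max-plus product. *)
Inductive trop (R : realType) : Type := NegInf | Fin of R.
Arguments NegInf {R}.
Arguments Fin {R} x.

Section Semiring.
Variable R : realType.
Implicit Types x y z : trop R.

Definition option_of_trop x : option R := if x is Fin a then Some a else None.
Definition trop_of_option (o : option R) : trop R :=
  if o is Some a then Fin a else NegInf.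

Lemma option_of_tropK : cancel option_of_trop trop_of_option.
Proof. by case. Qed.

HB.instance Definition _ := Choice.copy (trop R) (can_type option_of_tropK).

Definition trop_add x y : trop R :=
  match x, y with
  | NegInf, _ => y
  | _, NegInf => x
  | Fin a, Fin b => Fin (Num.max a b)
  end.

Definition trop_mul x y : trop R :=
  if (x, y) is (Fin a, Fin b) then Fin (a + b) else NegInf.

(* Only meaningful for y <> NegInf. *)
Definition trop_div x y : trop R :=
  if (x, y) is (Fin a, Fin b) then Fin (a - b) else NegInf.

Lemma trop_addA : associative trop_add.
Proof. by move=> [|a] [|b] [|c] //=; rewrite maxA. Qed.

Lemma trop_addC : commutative trop_add.
Proof. by move=> [|a] [|b] //=; rewrite maxC. Qed.

Lemma trop_add0 : left_id NegInf trop_add.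
Proof. by []. Qed.

Lemma trop_mulA : associative trop_mul.
Proof. by move=> [|a] [|b] [|c] //; rewrite /trop_mul /= addrA. Qed.

Lemma trop_mulC : commutative trop_mul.
Proof. by move=> [|a] [|b] //; rewrite /trop_mul /= addrC. Qed.

Lemma trop_mul1 : left_id (Fin 0) trop_mul.
Proof. by move=> [|a] //; rewrite /trop_mul /= add0r. Qed.

Lemma trop_mulDl : left_distributive trop_mul trop_add.
Proof. by move=> [|a] [|b] [|c] //; rewrite /trop_mul /= addr_maxl. Qed.

Lemma trop_mul0 : left_zero NegInf trop_mul.
Proof. by []. Qed.

Lemma trop_oner_neq0 : Fin 0 != NegInf :> trop R.
Proof. by []. Qed.

HB.instance Definition _ :=
  GRing.isNmodule.Build (trop R) trop_addA trop_addC trop_add0.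

HB.instance Definition _ :=
  GRing.Nmodule_isComNzSemiRing.Build (trop R)
    trop_mulA trop_mulC trop_mul1 trop_mulDl trop_mul0 trop_oner_neq0.

End Semiring.

Section Matrices.
Variables (R : realType) (n : nat).
Implicit Type A : 'M[trop R]_n.

(* Sum and product are those of [trop R]: this is the maximum over s of the
   real sums of the entries A i (s i). *)
Definition trop_det A : trop R := \sum_(s : 'S_n) \prod_i A i (s i).

End Matrices.

Definition trop_adj (R : realType) (n : nat) (A : 'M[trop R]_n) :
    'M[trop R]_n :=
  (\matrix_(i, j) trop_det (row' i (col' j A)))^T.

(* A^nabla; only meaningful when trop_det A <> NegInf. *)
Definition trop_nabla (R : realType) (n : nat) (A : 'M[trop R]_n) :
    'M[trop R]_n :=
  map_mx (fun x => trop_div x (trop_det A)) (trop_adj A).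

Definition generalized_inverse (S : pzSemiRingType) (n : nat)
    (A X : 'M[S]_n) : Prop :=
  A *m X *m A = A /\ X *m A *m X = X.

Lemma trop_det1E (R : realType) (A : 'M[trop R]_1) :
  trop_det A = A ord0 ord0.
Proof.
rewrite /trop_det (bigD1 (1%g : 'S_1)) //= [X in _ + X]big1 ?addr0; last first.
  move=> s s1; case/negP: s1; apply/eqP; apply/perm.permP => i.
  by rewrite !ord1.
by rewrite big_ord1 perm1.
Qed.

Lemma trop_det2E (R : realType) (A : 'M[trop R]_2) :
  trop_det A =
    A ord0 ord0 * A ord_max ord_max + A ord0 ord_max * A ord_max ord0.
Proof.
pose t : 'S_2 := tperm ord0 ord_max.
have ord2 (i : 'I_2) : i = ord0 \/ i = ord_max.
  by case: i => [[|[|//]] Hi]; [left | right]; apply: val_inj.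
rewrite /trop_det (bigD1 (1%g : 'S_2)) //= (bigD1 t) /=; last first.
  by apply/eqP => /perm.permP/(_ ord0); rewrite tpermL perm1.
rewrite [X in _ + (_ + X)]big1 ?addr0 => [|s /andP[s1 st]]; last first.
  case: (ord2 (s ord0)) (ord2 (s ord_max)) => s0 [] sm.
  - by have /perm_inj := etrans s0 (esym sm).
  - by case/negP: s1; apply/eqP; apply/perm.permP => i; rewrite perm1; case: (ord2 i) => ->.
  - by case/negP: st; apply/eqP; apply/perm.permP => i; case: (ord2 i) => ->;
      rewrite ?tpermL ?tpermR.
  - by have /perm_inj := etrans s0 (esym sm).
have -> : ord_max = lift ord0 ord0 :> 'I_2 by apply: val_inj.
rewrite !big_ord_recl !big_ord0 /= !mulr1 !perm1.
have e : lift ord0 ord0 = ord_max :> 'I_2 by apply: val_inj.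
by rewrite !e tpermL tpermR.
Qed.

Lemma trop_adj2E (R : realType) (A : 'M[trop R]_2) :
  [/\ trop_adj A ord0 ord0 = A ord_max ord_max,
      trop_adj A ord0 ord_max = A ord0 ord_max,
      trop_adj A ord_max ord0 = A ord_max ord0 &
      trop_adj A ord_max ord_max = A ord0 ord0].
Proof.
by split; rewrite !mxE trop_det1E !mxE; congr (A _ _); apply: val_inj.
Qed.

(* Main.v *)
Require Import Defs.
From mathcomp Require Import all_boot all_order all_algebra.
From mathcomp Require Import reals.
From mathcomp Require Import ring.

(** Write [A] with rows [(a, b)] and [(c, d)].  Tropical addition is idempotent,
    so every determinant term absorbs further copies of itself.  The product
    [A Adj(A) A] has the entry [a(ad + bc) + abc + abc] at position [(0, 0)], and
    the surplus [abc] is already a summand of [a |A|]; the other three entries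
    behave in the same way, which gives [A Adj(A) A = |A| A] without any
    division ([mulmx_trop_adj_mulmx]).

    For 2 x 2 matrices [Adj] is an involution that preserves the determinant.
    Applying this identity to [Adj(A)] therefore yields the mirror identity
    [Adj(A) A Adj(A) = |A| Adj(A)].  When [|A|] is finite it is invertible for
    the tropical product, [A^nabla] is [Adj(A)] scaled by that inverse
    ([trop_nablaE]), and the two identities become the two equations of a
    generalized inverse. *)

Import GRing.Theory.
Local Open Scope ring_scope.

Lemma trop_addxx (R : realType) : idempotent_op (@GRing.add (trop R)).
Proof. by case=> [|x] //; congr Fin; rewrite Order.POrderTheory.maxxx. Qed.

Lemma matrix2P (T : Type) (A B : 'M[T]_2) :
  A ord0 ord0 = B ord0 ord0 -> A ord0 ord_max = B ord0 ord_max ->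
  A ord_max ord0 = B ord_max ord0 -> A ord_max ord_max = B ord_max ord_max ->
  A = B.
Proof.
move=> e00 e01 e10 e11; apply/matrixP => i j.
have ord2 (k : 'I_2) : k = ord0 \/ k = ord_max.
  by case: k => [[|[|//]] ?]; [left | right]; apply: val_inj.
by case: (ord2 i) (ord2 j) => -> [] ->.
Qed.

Lemma mulmx2E (S : pzSemiRingType) (A B : 'M[S]_2) (i j : 'I_2) :
  (A *m B) i j = A i ord0 * B ord0 j + A i ord_max * B ord_max j.
Proof.
rewrite mxE big_ord_recl big_ord1.
by have -> : lift ord0 ord0 = ord_max :> 'I_2 by apply: val_inj.
Qed.

Lemma trop_adjK (R : realType) (A : 'M[trop R]_2) : trop_adj (trop_adj A) = A.
Proof.
have [e00 e01 e10 e11] := trop_adj2E A.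
have [f00 f01 f10 f11] := trop_adj2E (trop_adj A).
by apply: matrix2P; congruence.
Qed.

Lemma trop_det_adj (R : realType) (A : 'M[trop R]_2) :
  trop_det (trop_adj A) = trop_det A.
Proof.
have [e00 e01 e10 e11] := trop_adj2E A.
by rewrite !trop_det2E e00 e01 e10 e11 [X in X + _]mulrC.
Qed.

(** A subtraction-free form of Cramer's identity.  The off-diagonal entries of
    [A Adj(A)] do not cancel, but their contributions to the triple product are
    dominated by those of the determinant. *)
Lemma mulmx_trop_adj_mulmx (R : realType) (A : 'M[trop R]_2) :
  A *m trop_adj A *m A = trop_det A *: A.
Proof.
have [e00 e01 e10 e11] := trop_adj2E A.
(* [q] is the determinant term that the surplus summands duplicate. *)
have absorb (p q x : trop R) : (p + q) * x + (q * x + q * x) = (p + q) * x.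
  by rewrite trop_addxx mulrDl -addrA trop_addxx.
apply: matrix2P; rewrite !mulmx2E e00 e01 e10 e11 [RHS]mxE trop_det2E;
  set a := A ord0 ord0; set b := A ord0 ord_max;
  set c := A ord_max ord0; set d := A ord_max ord_max.
- by rewrite -[RHS]absorb; ring.
- by rewrite [a * d + _]addrC -[RHS]absorb; ring.
- by rewrite [a * d + _]addrC -[RHS]absorb; ring.
- by rewrite -[RHS]absorb; ring.
Qed.

Lemma trop_nablaE (R : realType) (n : nat) (A : 'M[trop R]_n) (x : R) :
  trop_det A = Fin x -> trop_nabla A = Fin (- x) *: trop_adj A.
Proof.
move=> detA; apply/matrixP => i j; rewrite !mxE detA mulrC.
by case: (trop_det _).
Qed.

Theorem theorem2p3 (R : realType) (A : 'M[trop R]_2) :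
  trop_det A <> NegInf -> generalized_inverse A (trop_nabla A).
Proof.
case detA: (trop_det A) => [|x] // _.
have Vx : Fin (- x) * Fin x = 1 :> trop R.
  by congr Fin; rewrite addNr.
have adjA := mulmx_trop_adj_mulmx R (trop_adj A).
rewrite trop_adjK trop_det_adj detA in adjA.
rewrite (trop_nablaE R 2 A x detA); split.
  by rewrite -scalemxAr -scalemxAl mulmx_trop_adj_mulmx detA scalerA Vx scale1r.
by rewrite -scalemxAr -!scalemxAl adjA !scalerA -mulrA Vx mulr1.
Qed.
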